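(* Let $(W^*,a^*,\lambda^*,Z^*,Y^* )\in E\times\mathbb{R}^+\times\mathcal{P}_W\times\mathcal{P}_W$ be a solution, together with its related Lagrange multipliers, of the double-sided limited liability problem $\sup_{(W,a)\in C_m^M}\mathbb{E}[U_P(X^a-W)]$. Then the following Borch rule for double-sided limited liability holds: on the event $\{Z^*=Y^*\}$ the ratio of marginal utilities of the Principal and the Agent is constant, namely $\mathbb{P}$-a.s. on $\{Z^*=Y^*\}$, $$\lambda^*=\frac{\tilde U_P'(X^{a^*}-W^* )}{\tilde U_A'(W^*-\kappa(a^* ))}\,\mathbf{1}_{\{Z^*=0\text{ and }Y^*=0\}}.$$
   Context: Let $\Omega$ be an uncountable sample space, $(\Omega,\mathbb{F},\mathbb{P})$ a probability space, $L^2(\Omega)$ the square-integrable real random variables, and $B\in L^2(\Omega)$. Fix $x_0\in\mathbb{R}$, $K>0$; set $X^a=x_0+a+B$ and $\kappa(a)=K a^2/2$. $E=L^2(\Omega)\times\mathbb{R}$. The utility functions $U_P,U_A:\mathbb{R}\to\mathbb{R}$ are continuous, twice differentiable, with $U_P'>0$, $U_P''\le 0$, $U_A'>0$, $U_A''\le 0$ and limit $-\infty$ at $-\infty$. Fix $0\le m\le y\le M$ and assume $\mathbb{E}[|U_P(X^0-y)|]<\infty$. Define $C_m^M=\{(W,a)\in E: m\le W\le M\ \mathbb{P}\text{-a.s.},\ \mathbb{E}[U_A(W-\kappa(a))]\ge U_A(y)\}$, $\mathcal{P}_W=\{Z\in L^2(\Omega): Z\ge0\ \mathbb{P}\text{-a.s.}\}$,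 $\tilde U_P=-U_P$, $\tilde U_A=-U_A$. It is assumed throughout that the problem admits a maximizer and that the expected utilities $(W,a)\mapsto\mathbb{E}[U_P(X^a-W)]$ and $(W,a)\mapsto\mathbb{E}[U_A(W-\kappa(a))]$ are Gâteaux differentiable. ''A solution together with its related Lagrange multipliers'' means: $(W^*,a^* )\in C_m^M$ is a maximizer (optimal actions may be taken nonnegative), and $\lambda^*\in\mathbb{R}^+=[0,\infty)$, $Z^*,Y^*\in\mathcal{P}_W$ satisfy the stationarity and slackness conditions (the expectations involved being finite): $\mathbb{E}[\tilde U_P'(X^{a^*}-W^* )]-\lambda^*\kappa'(a^* )\mathbb{E}[\tilde U_A'(W^*-\kappa(a^* ))]=0$; $-\tilde U_P'(X^{a^*}-W^* )+\lambda^*\tilde U_A'(W^*-\kappa(a^* ))-Z^*+Y^*=0$ $\mathbb{P}$-a.s.; $\lambda^*(\mathbb{E}[U_A(W^*-\kappa(a^* ))]-U_A(y))=0$; $\mathbb{E}[Z^*(W^*-m)]=0$ and $\mathbb{E}[Y^*(M-W^* )]=0$. *)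

(* Defs.v *)
From HB Require Import structures.
From mathcomp Require Import all_boot all_order all_algebra.
From mathcomp Require Import all_classical all_reals all_analysis.
Import Order.TTheory GRing.Theory Num.Theory.
Import numFieldNormedType.Exports.
Set Implicit Arguments.
Unset Strict Implicit.
Unset Printing Implicit Defensive.
Local Open Scope classical_set_scope.
Local Open Scope ring_scope.

Section Utility.
Context {R : realType}.

Record utility (U : R -> R) : Prop := Utility {
  utility_continuous : continuous U;
  utility_derivable : forall x, derivable U x 1;
  utility_derivable2 : forall x, derivable (derive1 U) x 1;
  utility_incr : forall x, 0 < derive1 U x;
  utility_concave : forall x, derive1n 2 U x <= 0;
  utility_limNy : U x @[x --> -oo] --> -oo }.

Definition kappa (K a : R) : R := K * a ^+ 2 / 2.

End Utility.

Section Model.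
Context {d : measure_display} {Omega : measurableType d} {R : realType}.
Variable P : probability Omega R.

Lemma one_le_two : (1 <= 2%:E :> \bar R)%E.
Proof. by rewrite lee_fin ler1n. Qed.

(* Elements of L2 are square-integrable functions, not classes modulo
   P-a.s. equality; all notions below are invariant under that equality. *)
Definition L2 := LfunType P one_le_two.

(* The second factor is R^o so that E carries the product vector space
   structure over R. *)
Definition E := (L2 * R^o)%type.

(* Directional derivatives exist in every direction and depend on it through
   a linear functional which is bounded, hence continuous, for the L2 norm. *)
Definition gateaux_differentiable (f : E -> R) : Prop :=
  forall p : E, exists D : {linear E -> R^o},
    (exists C : R, forall h : E,
      `|D h| <= C * (fine ('N[P]_2%:E[EFin \o h.1])%E + `|h.2|)) /\
    (forall h : E,
      t^-1 * (f (p + t *: h) - f p) @[t --> (0 : R)^'] --> (D h : R)).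

(* "p |-> E[g p] is Gateaux differentiable on E" includes that all these
   expectations are finite. *)
Definition gateaux_differentiable_expectation (g : E -> Omega -> R) : Prop :=
  (forall p, g p \in Lfun P 1%E) /\
  gateaux_differentiable (fun p => fine ('E_P[g p])%E).

Variables (x0 K m y M : R) (B : L2) (UP UA : R -> R).

Definition outcome (a : R) (w : Omega) : R := x0 + a + B w.

Definition principal_payoff (p : E) (w : Omega) : R :=
  UP (outcome p.2 w - p.1 w).

Definition agent_payoff (p : E) (w : Omega) : R :=
  UA (p.1 w - kappa K p.2).

Definition C_mM : set E :=
  [set p : E | (\forall w \ae P, m <= p.1 w <= M) /\
           ((UA y)%:E <= 'E_P[agent_payoff p])%E].

Definition P_W : set L2 := [set Z : L2 | \forall w \ae P, 0 <= Z w].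

Definition is_maximizer (p : E) : Prop :=
  C_mM p /\
  forall q, C_mM q -> ('E_P[principal_payoff q] <= 'E_P[principal_payoff p])%E.

(* Marginal (dis)utilities: derivatives of - UP and - UA at the contract. *)
Definition dtUP (p : E) (w : Omega) : R :=
  derive1 (\- UP) (outcome p.2 w - p.1 w).

Definition dtUA (p : E) (w : Omega) : R :=
  derive1 (\- UA) (p.1 w - kappa K p.2).

Record solution_with_multipliers (W : L2) (a lambda : R) (Z Y : L2) : Prop := {
  sol_maximizer : is_maximizer (W, a);
  sol_lambda : 0 <= lambda;
  sol_Z : P_W Z;
  sol_Y : P_W Y;
  sol_fin_dtUP : dtUP (W, a) \in Lfun P 1%E;
  sol_fin_dtUA : dtUA (W, a) \in Lfun P 1%E;
  sol_fin_UA : agent_payoff (W, a) \in Lfun P 1%E;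
  sol_fin_Z : (fun w => Z w * (W w - m)) \in Lfun P 1%E;
  sol_fin_Y : (fun w => Y w * (M - W w)) \in Lfun P 1%E;
  sol_stationary_a :
    ('E_P[dtUP (W, a)]
      - (lambda * derive1 (kappa K) a)%:E * 'E_P[dtUA (W, a)] = 0)%E;
  sol_stationary_W :
    \forall w \ae P,
      - dtUP (W, a) w + lambda * dtUA (W, a) w - Z w + Y w = 0;
  sol_slack_lambda :
    (lambda%:E * ('E_P[agent_payoff (W, a)] - (UA y)%:E) = 0)%E;
  sol_slack_Z : ('E_P[fun w => (Z w * (W w - m))%R] = 0)%E;
  sol_slack_Y : ('E_P[fun w => (Y w * (M - W w))%R] = 0)%E }.

End Model.

(* Main.v *)
Require Import Defs.
From mathcomp Require Import all_boot all_order all_algebra.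
From mathcomp Require Import all_classical all_reals all_analysis.
From mathcomp Require Import measurable_realfun lra.
Import Order.TTheory GRing.Theory Num.Theory.
Import numFieldNormedType.Exports.
Set Implicit Arguments.
Unset Strict Implicit.
Unset Printing Implicit Defensive.
Local Open Scope classical_set_scope.
Local Open Scope ring_scope.

(** The Borch rule comes from stationarity in the wage: almost surely on
    [Z = Y] it reads [dtUP = lambda * dtUA], and [dtUA < 0] because the Agent's
    utility is increasing, so the ratio [dtUP / dtUA] is the constant [lambda].

    The second claim amounts to [Z = Y = 0] almost surely on [Z = Y].
    Complementary slackness gives [Z * (W - m) = 0] and [Y * (M - W) = 0]
    almost surely ([complementary_slackness]), hence [Z * (M - m) = 0] where
    [Z = Y], and this forces [Z = 0] as soon as [m < M].

    The delicate case is [m = M], where both slackness conditions are vacuous.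
    It cannot occur ([liability_bounds_lt]): the wage is then the
    constant [y], the participation constraint leaves no room for a cost of
    effort, so [a = 0] and the marginal cost of effort vanishes.  Stationarity
    in the action then says that the expected marginal utility of the
    Principal is zero, although this marginal utility never vanishes. *)

Section UtilityTheory.
Context {R : realType}.
Implicit Types U : R -> R.

Lemma utility_lt U : utility U -> {homo U : x y / x < y}.
Proof.
move=> uU x y xy.
have dU z : z \in `]x, y[%R -> is_derive z 1 U (derive1 U z).
  by move=> _; rewrite derive1E; exact/derivableP/(utility_derivable uU).
have cU : {within `[x, y], continuous U}.
  by apply: continuous_subspaceT; exact: utility_continuous uU.
have [c _ UxyE] := MVT xy dU cU.
by rewrite -subr_gt0 UxyE mulr_gt0 ?subr_gt0// (utility_incr uU).
Qed.

Lemma derive1_oppU_lt0 U x : utility U -> derive1 (\- U) x < 0.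
Proof.
move=> uU; rewrite derive1E deriveN; last exact: utility_derivable uU x.
by rewrite oppr_lt0 -derive1E; exact: utility_incr uU x.
Qed.

End UtilityTheory.

Section Cost.
Context {R : realType}.

Lemma kappa_le0 (K a : R) : 0 < K -> kappa K a <= 0 -> a = 0.
Proof.
move=> K0; rewrite /kappa pmulr_lle0 ?invr_gt0// pmulr_rle0// => a2_le0.
by apply/eqP; rewrite -sqrf_eq0 eq_le a2_le0 sqr_ge0.
Qed.

Lemma derive1_kappa0 (K : R) : derive1 (kappa K) 0 = 0.
Proof.
have -> : kappa K = (fun x : R => (K / 2) * x ^+ 2).
  by apply/funext => x; rewrite /kappa mulrAC.
rewrite derive1Ml; last exact: exprn_derivable.
by rewrite exp_derive1 expr1 scaler0 mulr0.
Qed.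

End Cost.

Section AlmostSure.
Context {d : measure_display} {Omega : measurableType d} {R : realType}.
Variable P : probability Omega R.
Implicit Types X : Omega -> R.

Lemma Lfun1_measurable X : X \in Lfun P 1 -> measurable_fun setT X.
Proof. by move=> /sub_Lfun_mfun; rewrite inE. Qed.

Lemma ae_ge0_expectation_eq0 X : X \in Lfun P 1 ->
  (\forall w \ae P, 0 <= X w) -> ('E_P[X] = 0)%E -> \forall w \ae P, X w = 0.
Proof.
move=> /Lfun1_measurable /measurable_EFinP mX X0 EX.
have : ae_eq P setT (EFin \o X) (cst 0%E).
  apply/(ae_eq_integral_abs P measurableT mX).
  rewrite -[RHS]EX unlock; apply: ae_eq_integral => //.
    exact: measurableT_comp mX.
  by apply: filterS X0 => w Xw _ /=; rewrite ger0_norm.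
by apply: filterS => w /(_ I)[].
Qed.

Lemma expectation_ae_cst X (c : R) : X \in Lfun P 1 ->
  (\forall w \ae P, X w = c) -> ('E_P[X] = c%:E)%E.
Proof.
move=> /Lfun1_measurable /measurable_EFinP mX Xc.
rewrite -(expectation_cst P c) unlock; apply: ae_eq_integral => //.
  exact/measurable_EFinP.
by apply: filterS Xc => w Xw _ /=; rewrite Xw.
Qed.

Lemma expectation_lt0_neq0 X : X \in Lfun P 1 ->
  (forall w, X w < 0) -> ('E_P[X] != 0)%E.
Proof.
move=> X1 X0; apply/eqP => EX0.
have NX1 : (\- X) \in Lfun P 1 by rewrite rpredN.
have ENX : ('E_P[\- X] = 0)%E.
  have -> : (\- X) = -1 \o* X by apply/funext => w /=; rewrite mulrN1.
  by rewrite expectationZl// EX0 mule0.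
have NX0 : \forall w \ae P, 0 <= (\- X) w.
  by apply: aeW => w /=; rewrite oppr_ge0 ltW.
have PX : (0 < P setT)%E by rewrite probability_setT lte01.
have FP := ae_properfilter_algebraOfSetsType PX.
have [w] := filter_ex (ae_ge0_expectation_eq0 NX1 NX0 ENX).
by move=> /eqP; rewrite /= oppr_eq0 lt_eqF.
Qed.

End AlmostSure.

Section Multipliers.
Context {d : measure_display} {Omega : measurableType d} {R : realType}.
Variable P : probability Omega R.
Variables (x0 K m y M : R) (B : L2 P) (UP UA : R -> R).
Variables (W : L2 P) (a lambda : R) (Z Y : L2 P).
Hypotheses (K_gt0 : 0 < K) (uP : utility UP) (uA : utility UA).
Hypotheses (m_le_y : m <= y) (y_le_M : y <= M).
Hypothesis sol : solution_with_multipliers x0 K m y M B UP UA W a lambda Z Y.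

(** Both products are almost surely nonnegative, because the wage stays within
    its bounds, and they have zero expectation. *)
Lemma complementary_slackness :
  \forall w \ae P, Z w * (W w - m) = 0 /\ Y w * (M - W w) = 0.
Proof.
have [[Wb _] _] := sol_maximizer sol.
have ZW : \forall w \ae P, Z w * (W w - m) = 0.
  apply: ae_ge0_expectation_eq0 (sol_fin_Z sol) _ (sol_slack_Z sol).
  apply: filterS2 Wb (sol_Z sol) => w /andP[mW _] Zw.
  by rewrite mulr_ge0 ?subr_ge0.
have YW : \forall w \ae P, Y w * (M - W w) = 0.
  apply: ae_ge0_expectation_eq0 (sol_fin_Y sol) _ (sol_slack_Y sol).
  apply: filterS2 Wb (sol_Y sol) => w /andP[_ WM] Yw.
  by rewrite mulr_ge0 ?subr_ge0.
by apply: filterS2 ZW YW => w ? ?; split.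
Qed.

(** If [m = M] then the wage is almost surely [y] and the participation
    constraint becomes [UA y <= UA (y - kappa K a)], which leaves only [a = 0];
    there the marginal cost of effort is zero, and stationarity in the action
    makes the expectation of the negative function [dtUP] vanish. *)
Lemma liability_bounds_lt : m < M.
Proof.
rewrite lt_neqAle (le_trans m_le_y y_le_M) andbT; apply/eqP => mM.
have [[Wb UA_y] _] := sol_maximizer sol.
have UAE : ('E_P[agent_payoff K UA (W, a)] = (UA (y - kappa K a))%:E)%E.
  apply: expectation_ae_cst (sol_fin_UA sol) _.
  apply: filterS Wb => w /= /andP[mW WM].
  rewrite /agent_payoff /=; congr (UA (_ - _)).
  apply/eqP; rewrite eq_le.
  by rewrite (le_trans WM) -?mM//= (le_trans y_le_M) -?mM.
have a0 : a = 0.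
  apply: (kappa_le0 K_gt0); rewrite leNgt; apply/negP => ka_gt0.
  move: UA_y; rewrite UAE lee_fin leNgt => /negP; apply.
  by apply: utility_lt => //; rewrite gtrBl.
have := sol_stationary_a sol.
rewrite [in X in derive1 _ X]a0 derive1_kappa0 mulr0 mul0e sube0.
apply/eqP/expectation_lt0_neq0; first exact: sol_fin_dtUP sol.
by move=> w; exact: derive1_oppU_lt0.
Qed.

Lemma ae_multipliers_eq0 : \forall w \ae P, Z w = Y w -> Z w = 0 /\ Y w = 0.
Proof.
apply: filterS complementary_slackness => w [ZW YW] ZY.
suff Z0 : Z w = 0 by split; rewrite -?ZY.
(* The two slackness equations add up to this one where [Z = Y]. *)
have /eqP : Z w * (M - m) = 0.
  by rewrite -(subrKA (W w)) mulrDr ZW addr0 ZY YW.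
rewrite mulf_eq0 subr_eq0 => /orP[/eqP//|/eqP Mm].
by have := liability_bounds_lt; rewrite Mm ltxx.
Qed.

Lemma ae_marginal_ratio : \forall w \ae P, Z w = Y w ->
  dtUP x0 B UP (W, a) w / dtUA K UA (W, a) w = lambda.
Proof.
apply: filterS (sol_stationary_W sol) => w statW ZY.
have UA_neq0 : dtUA K UA (W, a) w != 0 by rewrite lt_eqF// derive1_oppU_lt0.
have -> : dtUP x0 B UP (W, a) w = lambda * dtUA K UA (W, a) w by lra.
by rewrite mulfK.
Qed.

End Multipliers.

Theorem mainTheorem4 (R : realType) (d : measure_display)
    (Omega : measurableType d) (P : probability Omega R)
    (Omega_uncountable : ~ countable [set: Omega])
    (B : L2 P) (x0 K : R) (K_gt0 : 0 < K)
    (UP UA : R -> R) (UP_utility : utility UP) (UA_utility : utility UA)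
    (m y M : R) (m_ge0 : 0 <= m) (m_le_y : m <= y) (y_le_M : y <= M)
    (UP_fin : ('E_P[fun w => `|UP (outcome x0 B 0 w - y)|%R] < +oo)%E)
    (gateaux_P :
      gateaux_differentiable_expectation (principal_payoff x0 B UP))
    (gateaux_A :
      gateaux_differentiable_expectation (@agent_payoff _ _ _ P K UA))
    (maximizer_exists : exists p : E P, is_maximizer x0 K m y M B UP UA p)
    (W : L2 P) (a lambda : R) (Z Y : L2 P)
    (sol : solution_with_multipliers x0 K m y M B UP UA W a lambda Z Y) :
  (exists c : R, \forall w \ae P, Z w = Y w ->
     dtUP x0 B UP (W, a) w / dtUA K UA (W, a) w = c) /\
  (\forall w \ae P, Z w = Y w ->
     lambda = dtUP x0 B UP (W, a) w / dtUA K UA (W, a) w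
              * \1_[set w' | Z w' = 0 /\ Y w' = 0] w).
Proof.
have ratio := ae_marginal_ratio UA_utility sol.
split; first by exists lambda.
have ZY0 := ae_multipliers_eq0  K_gt0 UP_utility UA_utility m_le_y y_le_M sol.
apply: filterS2 ratio ZY0 => w ratio_w ZY0_w ZY.
by rewrite ratio_w// indicE mem_set ?mulr1//; exact: ZY0_w.
Qed.
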